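(* Let $A$ be a monoid and let $MSpec(A)$ denote the set of all prime ideals of $A$, equipped with the Zariski topology, whose closed sets are the sets $V(I):=\{\mathfrak{p}\in MSpec(A)\mid I\subseteq \mathfrak{p}\}$ for ideals $I$ of $A$. Then $MSpec(A)$ is a spectral space.
   Context: A monoid means a commutative monoid, written multiplicatively, with identity $1$ and a base point $0$ satisfying $0\cdot a=0$ for all $a$. An ideal of $A$ is a subset $I\subseteq A$ containing $0$ with $IA\subseteq I$. An ideal $\mathfrak{p}\neq A$ is prime if $A\setminus\mathfrak{p}$ is closed under multiplication. A topological space is spectral if it is homeomorphic to the prime spectrum of a commutative ring with the Zariski topology; equivalently (Hochster) it is $T_0$, quasi-compact, has a basis of quasi-compact open subspaces closed under finite intersections, and every irreducible closed subspace has a unique generic point. *)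

(* Defs.v *)
From HB Require Import structures.
From mathcomp Require Import all_boot all_algebra.
From mathcomp Require Import all_classical.
From mathcomp Require Import topology.

Set Implicit Arguments.
Unset Strict Implicit.
Unset Printing Implicit Defensive.

Import GRing.Theory.

Local Open Scope classical_set_scope.

(* 0 = 1 is not excluded: the one-element monoid is allowed. *)
HB.mixin Record Monoid_isPointed A of Monoid A := {
  mzero : A;
  mmulC : forall a b : A, (a * b = b * a)%g;
  mmul0 : forall a : A, (mzero * a)%g = mzero
}.

#[short(type="pointedMonoidType")]
HB.structure Definition PointedMonoid := {A of Monoid_isPointed A & Monoid A}.

Section MonoidSpectrum.
Variable A : pointedMonoidType.
Implicit Types I J p : set A.

Definition monoid_ideal I : Prop :=
  I mzero /\ forall x a : A, I x -> I (x * a)%g.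

Definition monoid_prime p : Prop :=
  [/\ monoid_ideal p, p <> setT &
      forall a b : A, (~` p) a -> (~` p) b -> (~` p) (a * b)%g].

Record MSpec := MkMSpec {
  mspec_set :> set A;
  mspec_prime : monoid_prime mspec_set
}.

HB.instance Definition _ := gen_eqMixin MSpec.
HB.instance Definition _ := gen_choiceMixin MSpec.

Definition MV I : set MSpec := [set p : MSpec | I `<=` p].

Definition mspec_open (U : set MSpec) : Prop :=
  exists2 I, monoid_ideal I & ~` U = MV I.

Lemma mspec_openT : mspec_open setT.
Proof.
exists setT; first by [].
rewrite setCT; apply/esym/seteqP; split=> // p /= Ip.
by case: (mspec_prime p) => _ + _; apply; apply/seteqP; split.
Qed.

Lemma mspec_openI : setI_closed mspec_open.
Proof.
move=> U V [I idI UI] [J idJ VJ]; exists (I `&` J).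
  case: idI idJ => I0 IM [J0 JM]; split=> // x a [Ix Jx].
  by split; [exact: IM | exact: JM].
rewrite setCI UI VJ; apply/seteqP; split=> p.
  by case=> h x [Ix Jx]; apply: h.
move=> h; apply: contrapT => /not_orP[].
move=> /existsNP[x /not_implyP[Ix px]] /existsNP[y /not_implyP[Jy py]].
case: (mspec_prime p) => _ _ /(_ x y px py); apply; apply: h; split.
  by case: idI => _; apply.
by rewrite mmulC; case: idJ => _; apply.
Qed.

Lemma mspec_open_bigU (K : Type) (f : K -> set MSpec) :
  (forall i, mspec_open (f i)) -> mspec_open (\bigcup_i f i).
Proof.
move=> fo; pose G := [set x | exists i J, [/\ monoid_ideal J, ~` f i = MV J & J x]].
exists (smallest monoid_ideal G).
  split; first by move=> J [[? ?]].
  by move=> x a h J [[J0 JM] GJ]; apply: (JM); apply: h; split.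
rewrite setC_bigcup; apply/seteqP; split=> p.
  move=> h; apply: smallest_sub; first by case: (mspec_prime p).
  move=> x [i [J [_ e Jx]]]; have : (~` f i) p by apply: h.
  by rewrite e; apply.
move=> h i _; have [J idJ e] := fo i; rewrite e => x Jx.
by apply: h => M [_]; apply; exists i, J.
Qed.

HB.instance Definition _ := isOpenTopological.Build MSpec
  mspec_openT mspec_openI mspec_open_bigU.

Lemma mspec_closedE (C : set MSpec) :
  closed C <-> exists2 I, monoid_ideal I & C = MV I.
Proof. by rewrite -openC -[in X in _ <-> X](setCK C). Qed.

End MonoidSpectrum.

Section RingSpectrum.
Local Open Scope ring_scope.
(* comPzRingType includes the zero ring, whose spectrum is empty. *)
Variable R : comPzRingType.
Implicit Types I J p : set R.

Definition ring_ideal I : Prop :=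
  [/\ I 0, (forall x y : R, I x -> I y -> I (x + y)) &
      forall x a : R, I x -> I (x * a)].

Definition ring_prime p : Prop :=
  [/\ ring_ideal p, p <> setT &
      forall a b : R, (~` p) a -> (~` p) b -> (~` p) (a * b)].

Record Spec := MkSpec {
  spec_set :> set R;
  spec_prime : ring_prime spec_set
}.

HB.instance Definition _ := gen_eqMixin Spec.
HB.instance Definition _ := gen_choiceMixin Spec.

Definition RV I : set Spec := [set p : Spec | I `<=` p].

Definition spec_open (U : set Spec) : Prop :=
  exists2 I, ring_ideal I & ~` U = RV I.

Lemma spec_openT : spec_open setT.
Proof.
exists setT; first by [].
rewrite setCT; apply/esym/seteqP; split=> // p /= Ip.
by case: (spec_prime p) => _ + _; apply; apply/seteqP; split.
Qed.

Lemma spec_openI : setI_closed spec_open.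
Proof.
move=> U V [I idI UI] [J idJ VJ]; exists (I `&` J).
  case: idI idJ => I0 IA IM [J0 JA JM]; split=> // [x y [Ix Jx] [Iy Jy]|x a [Ix Jx]].
    by split; [exact: IA | exact: JA].
  by split; [exact: IM | exact: JM].
rewrite setCI UI VJ; apply/seteqP; split=> p.
  by case=> h x [Ix Jx]; apply: h.
move=> h; apply: contrapT => /not_orP[].
move=> /existsNP[x /not_implyP[Ix px]] /existsNP[y /not_implyP[Jy py]].
case: (spec_prime p) => _ _ /(_ x y px py); apply; apply: h; split.
  by case: idI => _ _; apply.
by rewrite mulrC; case: idJ => _ _; apply.
Qed.

Lemma spec_open_bigU (K : Type) (f : K -> set Spec) :
  (forall i, spec_open (f i)) -> spec_open (\bigcup_i f i).
Proof.
move=> fo; pose G := [set x | exists i J, [/\ ring_ideal J, ~` f i = RV J & J x]].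
exists (smallest ring_ideal G).
  split; first by move=> J [[? ? ?]].
    by move=> x y hx hy J [[J0 JA JM] GJ]; apply: (JA); [apply: hx | apply: hy]; split.
  by move=> x a h J [[J0 JA JM] GJ]; apply: (JM); apply: h; split.
rewrite setC_bigcup; apply/seteqP; split=> p.
  move=> h; apply: smallest_sub; first by case: (spec_prime p).
  move=> x [i [J [_ e Jx]]]; have : (~` f i) p by apply: h.
  by rewrite e; apply.
move=> h i _; have [J idJ e] := fo i; rewrite e => x Jx.
by apply: h => M [_]; apply; exists i, J.
Qed.

HB.instance Definition _ := isOpenTopological.Build Spec
  spec_openT spec_openI spec_open_bigU.

Lemma spec_closedE (C : set Spec) :
  closed C <-> exists2 I, ring_ideal I & C = RV I.
Proof. by rewrite -openC -[in X in _ <-> X](setCK C). Qed.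

End RingSpectrum.

Definition homeomorphic (X Y : topologicalType) : Prop :=
  exists (f : X -> Y) (g : Y -> X),
    [/\ continuous f, continuous g, cancel f g & cancel g f].

Definition spectral_space (X : topologicalType) : Prop :=
  exists R : comPzRingType, homeomorphic X (Spec R).

(* Main.v *)
Require Import Defs.
From mathcomp Require Import all_boot all_algebra.
From mathcomp Require Import all_classical topology.
From HB Require Import structures.

(** The ring is built by hand, as a ring of functions on X = MSpec A in the
spirit of Hochster's construction.

Let K be the fraction field of Z[x_a : a in A].  A subset F of A gives a
discrete valuation of K, or place: replace x_a by s x_a for every a outside F
and read off the order in s at s = 0.  When the order is nonnegative, the value
at s = 0 is again an element of K, the residue along F.  Thus x_a has residue x_a if a is in F, and 0 otherwise.

The ring R ([place_ring]) consists of the functions f : X -> K such that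
- f is finitary: f p depends only on the trace of p on a finite subset of A;
- whenever q is contained in p, f p is the residue of f q along the
  complement of p.
The first condition makes f constructible, and the second one makes the
nonvanishing locus of f stable under generization.  The function
p |-> x_a (or 0 when a is in p) belongs to R and vanishes exactly at the primes
containing a ([place_ring_gen]).

The point of R is a Nullstellensatz ([prime_nullstellensatz]): if f vanishes at
all the common zeros of finitely many elements of a prime P of R, then f is in
P.  Two facts carry it.
- If f vanishes wherever g does, then f^N / g, extended by 0 to the zeros of g,
  is again in R once N is large, so f^N is a multiple of g
  ([vanishing_radical]).  The exponent must exceed the order of every value of
  g at every place; it exists because g takes finitely many values and because
  the order of a fixed element of K is bounded independently of the place
  ([residue_bound]).
- For a suitable integer n, f + n g vanishes only at the common zeros of f and
  g, since only finitely many ratios f p / g p occur ([generic_combination]).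
  So finitely many elements can be traded for a single one.

Consequently a prime P of R is determined by the set p of all a whose function
lies in P, this p is a prime of A, and P is the set of the f vanishing at p.
This makes X -> Spec R bijective.  It is a homeomorphism because the
nonvanishing loci of elements of R are open in X ([place_ring_neq0_open]),
which uses that the union of two primes of a monoid is prime. *)

Set Implicit Arguments.
Unset Strict Implicit.
Unset Printing Implicit Defensive.
Import GRing.Theory.
Local Open Scope classical_set_scope.
Local Open Scope ring_scope.

(** * Polynomials in an arbitrary set of variables *)

(** Formal polynomials.  They are interpreted in several rings (integers,
univariate polynomials over the integers, univariate polynomials over
[polyfun I]); the interpretations are compared by [peval_morph]. *)
Inductive pexpr (I : Type) : Type :=
| PVar of I
| POne
| PSub of pexpr I & pexpr I
| PMul of pexpr I & pexpr I.
Arguments POne {I}.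

Fixpoint peval I (R : pzRingType) (env : I -> R) (t : pexpr I) : R :=
  match t with
  | PVar i => env i
  | POne => 1
  | PSub t1 t2 => peval env t1 - peval env t2
  | PMul t1 t2 => peval env t1 * peval env t2
  end.

Fixpoint pdegree I (t : pexpr I) : nat :=
  match t with
  | PVar _ => 1
  | POne => 0
  | PSub t1 t2 => maxn (pdegree t1) (pdegree t2)
  | PMul t1 t2 => pdegree t1 + pdegree t2
  end.

Lemma peval_morph I (R S : pzRingType) (f : {rmorphism R -> S})
    (env : I -> R) (t : pexpr I) :
  f (peval env t) = peval (f \o env) t.
Proof.
by elim: t => //= [|t1 <- t2 <-|t1 <- t2 <-]; rewrite (rmorph1, rmorphB, rmorphM).
Qed.

Lemma eq_peval I (R : pzRingType) (e1 e2 : I -> R) (t : pexpr I) :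
  e1 =1 e2 -> peval e1 t = peval e2 t.
Proof. by move=> e12; congr peval; apply/funext. Qed.

Lemma size_peval I (R : nzRingType) (env : I -> {poly R}) (t : pexpr I) :
  (forall i, size (env i) <= 2)%N -> (size (peval env t) <= (pdegree t).+1)%N.
Proof.
move=> env2; elim: t => //= [|t1 IH1 t2 IH2|t1 IH1 t2 IH2].
- by rewrite size_poly1.
- rewrite (leq_trans (size_polyD _ _)) // size_polyN.
  by rewrite geq_max !(leq_trans IH1, leq_trans IH2) // ltnS (leq_maxl, leq_maxr).
- rewrite (leq_trans (size_polyMleq _ _)) //.
  by move: (leq_add IH1 IH2); rewrite addSn addnS; case: addn.
Qed.

Lemma int_poly_eq0 (q : {poly int}) : (forall s, q.[s] = 0) -> q = 0.
Proof.
move=> q0; apply/eqP/negPn/negP => /max_poly_roots h.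
have := h [seq Posz n | n <- iota 0 (size q)]; rewrite size_map size_iota ltnn.
rewrite map_inj_uniq ?iota_uniq//; last by move=> ? ? [].
by move=> hh; suff : false by []; apply: hh => //; apply/allP => z _; apply/eqP/q0.
Qed.

(** The ring Z[x_i : i in I], for I of any cardinality, is realized as the ring
of polynomial functions on Z^I; this is faithful because Z is an infinite
domain. *)
Definition polyfun_pred I : {pred (I -> int) -> int} :=
  fun phi => `[< exists t, forall u, phi u = peval u t >].

Lemma polyfun_subring_closed I : subring_closed (@polyfun_pred I).
Proof.
split=> [|f g /asboolP[t ft] /asboolP[t' gt']|f g /asboolP[t ft] /asboolP[t' gt']];
  apply/asboolP.
- by exists POne.
- by exists (PSub t t') => u /=; rewrite -ft -gt'.
- by exists (PMul t t') => u /=; rewrite -ft -gt'.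
Qed.

Record polyfun I := PolyFun {
  polyfun_val :> (I -> int) -> int;
  _ : polyfun_val \in @polyfun_pred I }.
HB.instance Definition _ I := [isSub for @polyfun_val I].
HB.instance Definition _ I := [Choice of polyfun I by <:].
HB.instance Definition _ I := GRing.SubChoice_isSubComPzRing.Build
  _ _ (polyfun I) (@polyfun_subring_closed I).

Lemma polyfunP I (x y : polyfun I) : x =1 y -> x = y.
Proof. by move=> xy; apply/val_inj/funext. Qed.

Section PolyFunTheory.
Variable I : Type.
Implicit Types (x y : polyfun I) (u v : I -> int).

Lemma polyfun_neq0 : (1 : polyfun I) != 0.
Proof. by apply/eqP => /(congr1 (fun x : polyfun I => x (fun=> 0))). Qed.
HB.instance Definition _ := GRing.PzSemiRing_isNonZero.Build (polyfun I) polyfun_neq0.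

Lemma polyfun_expr x : exists t, forall u, x u = peval u t.
Proof. by case: x => x /= /asboolP. Qed.

(** Invertibility is decided classically, to make [polyfun I] an integral domain
with a field of fractions. *)
Definition polyfun_unit : {pred polyfun I} := fun x => `[< exists y, y * x = 1 >].
Definition polyfun_inv x := xget x [set y | y * x = 1].

Lemma polyfun_mulVr : {in polyfun_unit, left_inverse 1 polyfun_inv *%R}.
Proof. by move=> x /asboolP [y yx]; rewrite /polyfun_inv; case: xgetP => [z _|/(_ y)]. Qed.
Lemma polyfun_unitP x y : y * x = 1 -> polyfun_unit x.
Proof. by move=> yx; apply/asboolP; exists y. Qed.
Lemma polyfun_invr_out : {in [predC polyfun_unit], polyfun_inv =1 id}.
Proof.
move=> x /negP xN; rewrite /polyfun_inv; case: xgetP => [z _ zx|//].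
by case: xN; apply: polyfun_unitP zx.
Qed.
HB.instance Definition _ := GRing.ComNzRing_hasMulInverse.Build (polyfun I)
  polyfun_mulVr polyfun_unitP polyfun_invr_out.

(** The restriction to the line through two points is a one-variable
polynomial.  This reduces [polyfun_idomain] to Z[s]: join by a line a point
where x is nonzero to a point where y is nonzero. *)
Lemma polyfun_line x u v : exists q : {poly int},
  forall s, q.[s] = x (fun i => u i + (v i - u i) * s).
Proof.
have [t xt] := polyfun_expr x.
exists (peval (fun i => (u i)%:P + (v i - u i)%:P * 'X) t) => s.
rewrite xt -[LHS]/(horner_eval s _) peval_morph; apply: eq_peval => i /=.
by rewrite /horner_eval !hornerE.
Qed.

Lemma polyfun_idomain x y : x * y = 0 -> (x == 0) || (y == 0).
Proof.
move=> xy0; apply/negPn/negP; rewrite negb_or => /andP[/eqP x0 /eqP y0].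
have [u xu] : exists u, x u != 0.
  by apply: contrapT => h; apply/x0/polyfunP => u; apply: contra_notP h => /eqP; exists u.
have [v yv] : exists v, y v != 0.
  by apply: contrapT => h; apply/y0/polyfunP => v; apply: contra_notP h => /eqP; exists v.
have [p px] := polyfun_line x u v; have [q qy] := polyfun_line y u v.
have /eqP : p * q = 0.
  apply: int_poly_eq0 => s; rewrite hornerM px qy.
  exact: (congr1 (fun z : polyfun I => z _) xy0).
rewrite mulf_eq0 => /orP[] /eqP e0; move: xu yv.
  suff -> : x u = p.[0] by rewrite e0 horner0 eqxx.
  by rewrite px; congr (polyfun_val x _); apply/funext => i; rewrite mulr0 addr0.
suff -> : y v = q.[1] by rewrite e0 horner0 eqxx.
by rewrite qy; congr (polyfun_val y _); apply/funext => i; rewrite mulr1 addrC subrK.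
Qed.
HB.instance Definition _ := GRing.ComUnitRing_isIntegral.Build (polyfun I) polyfun_idomain.

Lemma pvar_subproof i : (fun u : I -> int => u i) \in @polyfun_pred I.
Proof. by apply/asboolP; exists (PVar i). Qed.
Definition pvar i : polyfun I := PolyFun (pvar_subproof i).

Definition pvalue u x : int := x u.
Lemma pvalue_zmod u : zmod_morphism (pvalue u). Proof. by []. Qed.
Lemma pvalue_monoid u : monoid_morphism (pvalue u). Proof. by []. Qed.
HB.instance Definition _ u := GRing.isZmodMorphism.Build _ _ (pvalue u) (pvalue_zmod u).
HB.instance Definition _ u := GRing.isMonoidMorphism.Build _ _ (pvalue u) (pvalue_monoid u).

Lemma pvar_neq0 i : pvar i != 0.
Proof. by apply/eqP => /(congr1 (pvalue (fun=> 1))). Qed.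

(** * The expansion along a set of variables *)

Variable F : set I.

Definition contract (s : int) u : I -> int :=
  fun i => if `[< F i >] then u i else u i * s.

(** [Phi] is the image of [x] under the substitution multiplying by s the
variables outside [F]; it is a polynomial in s over [polyfun I].  Only its
specializations to integers are compared, which determines it by
[int_poly_eq0]. *)
Definition expansion x (Phi : {poly polyfun I}) :=
  forall u s, x (contract s u) = (map_poly (pvalue u) Phi).[s].

Lemma expansion1 : expansion 1 1.
Proof. by move=> u s; rewrite rmorph1 hornerE. Qed.
Lemma expansionB x y Phi Psi :
  expansion x Phi -> expansion y Psi -> expansion (x - y) (Phi - Psi).
Proof. by move=> hx hy u s; rewrite rmorphB hornerD hornerN -hx -hy. Qed.
Lemma expansionM x y Phi Psi :
  expansion x Phi -> expansion y Psi -> expansion (x * y) (Phi * Psi).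
Proof. by move=> hx hy u s; rewrite rmorphM hornerM -hx -hy. Qed.
Lemma expansionX x Phi n : expansion x Phi -> expansion (x ^+ n) (Phi ^+ n).
Proof.
by move=> hx; elim: n => [|n IH]; [exact: expansion1 | rewrite !exprS; exact: expansionM].
Qed.

Lemma expansion_pvar i :
  expansion (pvar i) (if `[< F i >] then (pvar i)%:P else (pvar i)%:P * 'X).
Proof.
move=> u s /=; rewrite /contract; case: ifP => _;
by rewrite ?rmorphM /= ?map_polyC ?map_polyX ?hornerE.
Qed.

Lemma expansion_0l Phi : expansion 0 Phi -> Phi = 0.
Proof.
move=> h; apply/polyP => k; rewrite coef0; apply/polyfunP => u.
have e0 : map_poly (pvalue u) Phi = 0 by apply: int_poly_eq0 => s; rewrite -h.
by have := congr1 (fun q : {poly int} => q`_k) e0; rewrite coef_map coef0.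
Qed.

(** The substitution is injective, since s = 1 gives back [x]. *)
Lemma expansion_0r x : expansion x 0 -> x = 0.
Proof.
move=> h; apply/polyfunP => u; have := h u 1; rewrite rmorph0 hornerE; apply: etrans.
by congr (polyfun_val x _); apply/funext => i; rewrite /contract mulr1 if_same.
Qed.
End PolyFunTheory.

(** The bound [N] does not depend on [F]: this uniformity is what eventually
makes the exponent in [vanishing_radical] exist. *)
Lemma expansion_ex I (x : polyfun I) : exists N : nat,
  forall F, exists2 Phi, expansion F x Phi & (size Phi <= N)%N.
Proof.
have [t xt] := polyfun_expr x; exists (pdegree t).+1 => F.
pose env i : {poly polyfun I} := if `[< F i >] then (pvar i)%:P else (pvar i)%:P * 'X.
exists (peval env t).
  move=> u s; rewrite xt.
  rewrite peval_morph -[RHS]/(horner_eval s _) peval_morph.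
  by apply: eq_peval => i; rewrite /= /horner_eval -(expansion_pvar F i u s).
apply: size_peval => i; rewrite /env; case: ifP => _.
  by rewrite size_polyC; case: (_ != 0).
by rewrite mul_polyC size_scale ?pvar_neq0 // size_polyX.
Qed.

(** * The places of the fraction field *)

Local Notation "x %:F" := (@FracField.tofrac _ x).

Lemma frac_numden (D : idomainType) (z : {fraction D}) :
  exists p q : D, q != 0 /\ z = p%:F / q%:F.
Proof.
elim/quotW: z => x; exists (frac x).1, (frac x).2; split; first exact: denom_ratioP.
apply: (@mulIf _ ((frac x).2)%:F); first by rewrite tofrac_eq0 denom_ratioP.
rewrite divfK ?tofrac_eq0 ?denom_ratioP // [RHS]piE -[LHS]/(FracField.mul _ _) !piE.
apply/eqmodP; rewrite /= FracField.equivfE /FracField.mulf.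
by rewrite !numden_Ratio ?mulf_neq0 ?oner_eq0 ?denom_ratioP // !mulr1 mulrC.
Qed.

Section Residue.
Variable I : Type.
Local Notation P := (polyfun I).
Local Notation K := {fraction P}.

(** The valuation is the order in s of the expansion.  A common power of s is
cancelled from the expansions of the numerator and the denominator; if the
denominator then does not vanish at s = 0, the quotient of the two values at
s = 0 is the residue.  In particular [has_residue F z 0] says that z has
positive valuation. *)
Definition has_residue (F : set I) (z c : K) : Prop :=
  exists p q : P, exists n (Phi Psi : {poly P}),
    [/\ expansion F p ('X^n * Phi), expansion F q ('X^n * Psi), Psi`_0 != 0,
        z = p%:F / q%:F & c = (Phi`_0)%:F / (Psi`_0)%:F].

Lemma expansion_neq0 F (q : P) n (Psi : {poly P}) :
  expansion F q ('X^n * Psi) -> Psi`_0 != 0 -> q != 0.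
Proof.
move=> qPsi Psi0; apply: contra_neq Psi0 => q0; move: qPsi; rewrite q0.
by move=> /expansion_0l/eqP; rewrite mulf_eq0 expf_eq0 polyX_eq0 andbF => /eqP ->; rewrite coef0.
Qed.

Section Fixed_F.
Variable F : set I.

Lemma has_residue_expansion (p : P) (Phi : {poly P}) :
  expansion F p Phi -> has_residue F p%:F (Phi`_0)%:F.
Proof.
move=> pPhi; exists p, 1, 0, Phi, 1; split.
- by rewrite expr0 mul1r.
- by rewrite expr0 mul1r; apply: expansion1.
- by rewrite coef1 oner_neq0.
- by rewrite (tofrac1 P) divr1.
- by rewrite coef1 (tofrac1 P) divr1.
Qed.

Lemma has_residue1 : has_residue F 1 1.
Proof.
have := has_residue_expansion (expansion1 F).
by rewrite coef1 (tofrac1 P).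
Qed.

Lemma has_residueM z1 z2 c1 c2 : has_residue F z1 c1 -> has_residue F z2 c2 ->
  has_residue F (z1 * z2) (c1 * c2).
Proof.
move=> [p1 [q1 [n1 [f1 [g1 [pf1 qg1 g10 -> ->]]]]]].
move=> [p2 [q2 [n2 [f2 [g2 [pf2 qg2 g20 -> ->]]]]]].
exists (p1 * p2), (q1 * q2), (n1 + n2)%N, (f1 * f2), (g1 * g2); split.
- by rewrite exprD mulrACA; apply: expansionM.
- by rewrite exprD mulrACA; apply: expansionM.
- by rewrite coef0M mulf_neq0.
- by rewrite !tofracM invfM mulrACA.
- by rewrite !coef0M !tofracM invfM mulrACA.
Qed.

Lemma has_residueB z1 z2 c1 c2 : has_residue F z1 c1 -> has_residue F z2 c2 ->
  has_residue F (z1 - z2) (c1 - c2).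
Proof.
move=> [p1 [q1 [n1 [f1 [g1 [pf1 qg1 g10 -> ->]]]]]].
move=> [p2 [q2 [n2 [f2 [g2 [pf2 qg2 g20 -> ->]]]]]].
have q10 := expansion_neq0 qg1 g10; have q20 := expansion_neq0 qg2 g20.
exists (p1 * q2 - p2 * q1), (q1 * q2), (n1 + n2)%N, (f1 * g2 - f2 * g1), (g1 * g2).
split.
- rewrite mulrBr; apply: expansionB.
    by rewrite exprD mulrACA; apply: expansionM.
  by rewrite addnC exprD mulrACA; apply: expansionM.
- by rewrite exprD mulrACA; apply: expansionM.
- by rewrite coef0M mulf_neq0.
- by rewrite -mulNr addf_div ?tofrac_eq0 // !(tofracB, tofracM) mulNr.
- by rewrite -mulNr addf_div ?tofrac_eq0 // coefB !coef0M !(tofracB, tofracM) mulNr.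
Qed.

Lemma has_residue_0l c : has_residue F 0 c -> c = 0.
Proof.
move=> [p [q [n [f [g [pf qg g0 /esym/eqP + ->]]]]]].
have q0 := expansion_neq0 qg g0.
rewrite mulf_eq0 invr_eq0 !tofrac_eq0 (negPf q0) orbF => /eqP p0.
suff -> : f = 0 by rewrite coef0 tofrac0 mul0r.
apply/eqP; move: pf; rewrite p0 => /expansion_0l/eqP.
by rewrite mulf_eq0 expf_eq0 polyX_eq0 andbF.
Qed.

Lemma has_residueV z c : c != 0 -> has_residue F z c -> has_residue F z^-1 c^-1.
Proof.
move=> + [p [q [n [f [g [pf qg g0 -> e]]]]]].
rewrite e mulf_eq0 invr_eq0 !tofrac_eq0 negb_or => /andP[f0 _].
by exists q, p, n, g, f; split; rewrite // ?invf_div.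
Qed.

Lemma has_residue_pvar i : F i -> has_residue F (pvar i)%:F (pvar i)%:F.
Proof.
move=> Fi; have := has_residue_expansion (expansion_pvar F i).
by rewrite asboolT // coefC.
Qed.

Lemma has_residue_pvar0 i : ~ F i -> has_residue F (pvar i)%:F 0.
Proof.
move=> Fi; have := has_residue_expansion (expansion_pvar F i).
by rewrite asboolF // coefMX (tofrac0 P).
Qed.
End Fixed_F.

(** If z = p / q, the valuation of z is at most that of p, hence at most the
s-degree of the expansion of p, which is bounded independently of F.  Powers
y^m of an element of positive valuation have valuation at least m. *)
Lemma has_residue_bound (z : K) : z != 0 -> exists N : nat,
  forall F m y, (N <= m)%N -> has_residue F y 0 -> has_residue F (y ^+ m / z) 0.
Proof.
have [p [q [q0 ->]]] := frac_numden z.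
rewrite mulf_eq0 invr_eq0 !tofrac_eq0 (negPf q0) orbF => p0.
have [N Np] := expansion_ex p; exists N.+1 => F m y Nm.
move=> [a [b [n [f [g [af bg g0 -> /esym/eqP]]]]]].
have b0 := expansion_neq0 bg g0.
rewrite mulf_eq0 invr_eq0 !tofrac_eq0 (negPf g0) orbF => /eqP f0.
have [Phi pPhi PhiN] := Np F.
have [Theta qTheta] : exists Theta, expansion F q Theta.
  by have [? /(_ F)[Theta]] := expansion_ex q; exists Theta.
have Phi0 : Phi != 0.
  by apply: contra_neq p0 => Phi0; apply: expansion_0r; rewrite -Phi0.
have [h] : exists h, f = h * ('X - 0%:P).
  by apply/factor_theorem/rootP; rewrite horner_coef0.
have [k [r /implyP]] := multiplicity_XsubC Phi 0.
rewrite Phi0 /root horner_coef0 subr0 => /(_ isT) r0 Phir fh.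
have r_neq0 : r != 0 by apply: contra_neq r0 => ->; rewrite coef0.
have kN : (k <= N)%N.
  apply: leq_trans PhiN; rewrite Phir size_mulXn //.
  by rewrite leq_addr.
(* With y = a / b, z = p / q and s^k the exact power of s dividing the expansion
   of p, both expansions are divisible by s^(n m + k), and the numerator is
   divisible by the further factor s^(m - k). *)
exists (a ^+ m * q), (b ^+ m * p), (n * m + k)%N.
exists (h ^+ m * Theta * 'X^(m - k)), (g ^+ m * r); split.
- have -> : 'X^(n * m + k) * (h ^+ m * Theta * 'X^(m - k)) = ('X^n * f) ^+ m * Theta.
    have Xm : 'X^m = 'X^k * 'X^(m - k) :> {poly P}.
      by rewrite -exprD subnKC // (leq_trans kN) // ltnW.
    rewrite fh !exprMn -exprM Xm exprD -!mulrA.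
    by rewrite ['X^k * (h ^+ m * _)]mulrCA [Theta * _]mulrC.
  by apply: expansionM qTheta; apply: expansionX.
- have -> : 'X^(n * m + k) * (g ^+ m * r) = ('X^n * g) ^+ m * Phi.
    by rewrite Phir exprMn -exprM exprD mulrACA [r * _]mulrC.
  by apply: expansionM => //; apply: expansionX.
- by rewrite -horner_coef0 hornerM horner_exp !horner_coef0 mulf_neq0 // expf_neq0.
- by rewrite !(tofracM, tofracXn) expr_div_n invf_div mulrACA -invfM.
- rewrite !coef0M coefXn (ltn_eqF (_ : 0 < m - k)%N) ?subn_gt0 ?(leq_ltn_trans kN) //.
  by rewrite mulr0 (tofrac0 P) mul0r.
Qed.
End Residue.

(** The interface between the field of fractions and the ring of functions:
for each F, the residue is a partially defined ring morphism, single-valued by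
[residueB] and [residue_0l].  The order of quantifiers in [residue_bound] makes
the exponent uniform in F. *)
Record place_system (I : Type) := PlaceSystem {
  place_field :> fieldType;
  residue : set I -> place_field -> place_field -> Prop;
  generator : I -> place_field;
  natr_place_inj : injective (fun n : nat => n%:R : place_field);
  generator_neq0 : forall i, generator i != 0;
  residue1 : forall F, residue F 1 1;
  residueB : forall F y z c d,
    residue F y c -> residue F z d -> residue F (y - z) (c - d);
  residueM : forall F y z c d,
    residue F y c -> residue F z d -> residue F (y * z) (c * d);
  residueV : forall F z c, c != 0 -> residue F z c -> residue F z^-1 c^-1;
  residue_0l : forall F c, residue F 0 c -> c = 0;
  residue_generator : forall (F : set I) i,
    F i -> residue F (generator i) (generator i);
  residue_generator0 : forall (F : set I) i, ~ F i -> residue F (generator i) 0;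
  residue_bound : forall z, z != 0 -> exists N : nat,
    forall F m y, (N <= m)%N -> residue F y 0 -> residue F (y ^+ m / z) 0 }.

Lemma polyfun_natr_inj I : injective (fun n : nat => n%:R : {fraction polyfun I}).
Proof.
move=> m n /eqP; rewrite -!(rmorph_nat (@FracField.tofrac (polyfun I))) tofrac_eq => /eqP.
by move=> /(congr1 (pvalue (fun=> 0))); rewrite !rmorph_nat !natz => -[].
Qed.

Lemma polyfun_generator_neq0 I (i : I) : (pvar i)%:F != 0.
Proof. by rewrite tofrac_eq0 pvar_neq0. Qed.

Definition polyfun_places I : place_system I :=
  @PlaceSystem I {fraction polyfun I} (@has_residue I) (fun i => (pvar i)%:F)
    (@polyfun_natr_inj I) (@polyfun_generator_neq0 I) (@has_residue1 I)
    (@has_residueB I) (@has_residueM I) (@has_residueV I) (@has_residue_0l I)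
    (@has_residue_pvar I) (@has_residue_pvar0 I) (@has_residue_bound I).

Section PlaceTheory.
Variables (I : Type) (K : place_system I) (F : set I).
Implicit Types y z c d : K.

Lemma residue0 : @residue I K F 0 0.
Proof. by rewrite -(subrr 1); apply: residueB; apply: residue1. Qed.

Lemma residueX z c n : residue F z c -> residue F (z ^+ n) (c ^+ n).
Proof.
move=> h; elim: n => [|n IH]; first exact: residue1.
by rewrite !exprS; apply: residueM.
Qed.
End PlaceTheory.

Lemma residue_bound_seq (I : Type) (K : place_system I) (vs : seq K) :
  exists N : nat, forall z, z \in vs -> z != 0 ->
    forall F m y, (N <= m)%N -> residue F y 0 -> residue F (y ^+ m / z) 0.
Proof.
elim: vs => [|v vs [N IH]]; first by exists 0.
have [->|/residue_bound[M vM]] := eqVneq v 0.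
  by exists N => z; rewrite inE => /orP[/eqP -> /eqP //|/IH].
exists (maxn M N) => z; rewrite inE => /orP[/eqP -> _|zvs z0] F m y;
  rewrite geq_max => /andP[Mm Nm]; first exact: vM.
exact: (IH z).
Qed.

(** * The ring of place-compatible functions on the spectrum *)

Section PlaceRing.
Variables (A : pointedMonoidType) (K : place_system A).
Implicit Types (p q : MSpec A).

Definition agree (s : seq A) p q := forall a, a \in s -> mspec_set p a <-> mspec_set q a.

Definition finitary (f : MSpec A -> K) :=
  exists s, forall p q, agree s p q -> f p = f q.

(** The complement of p is contained in that of q, and the residue makes the
generators in p but not in q specialize to 0. *)
Definition place_compatible (f : MSpec A -> K) :=
  forall p q, q `<=` p -> residue (~` p) (f q) (f p).

Definition place_ring_pred : {pred MSpec A -> K} :=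
  fun f => `[< finitary f /\ place_compatible f >].

Lemma finitary2 (op : K -> K -> K) f g :
  finitary f -> finitary g -> finitary (fun p => op (f p) (g p)).
Proof.
move=> [s fs] [t gt]; exists (s ++ t) => p q pq.
congr op; [apply: fs|apply: gt] => a ha; apply: pq;
by rewrite mem_cat ha ?orbT.
Qed.

Lemma place_ring_subring_closed : subring_closed place_ring_pred.
Proof.
split=> [|f g /asboolP[ff fc] /asboolP[gf gc]|f g /asboolP[ff fc] /asboolP[gf gc]];
  apply/asboolP; split.
- by exists [::].
- by move=> p q _; apply: residue1.
- exact: finitary2 (fun y z => y - z) _ _ ff gf.
- by move=> p q qp; apply: residueB; [apply: fc|apply: gc].
- exact: finitary2 *%R _ _ ff gf.
- by move=> p q qp; apply: residueM; [apply: fc|apply: gc].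
Qed.

Record place_ring := PlaceRing {
  place_ring_val :> MSpec A -> K;
  _ : place_ring_val \in place_ring_pred }.
HB.instance Definition _ := [isSub for place_ring_val].
HB.instance Definition _ := [Choice of place_ring by <:].
HB.instance Definition _ := GRing.SubChoice_isSubComPzRing.Build
  _ _ place_ring place_ring_subring_closed.

Implicit Types f g h : place_ring.

Lemma place_ringP f g : f =1 g -> f = g.
Proof. by move=> fg; apply/val_inj/funext. Qed.

Lemma place_ring_finitary f : finitary f.
Proof. by case: f => f /= /asboolP[]. Qed.

Lemma place_ring_residue f p q : q `<=` p -> residue (~` p) (f q) (f p).
Proof. by case: f => f /= /asboolP[_]; apply. Qed.

Lemma place_ringED f g p : (f + g) p = f p + g p. Proof. by []. Qed.
Lemma place_ringEM f g p : (f * g) p = f p * g p. Proof. by []. Qed.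
Lemma place_ringEX f n p : (f ^+ n) p = f p ^+ n.
Proof. by elim: n => // n IH; rewrite !exprS place_ringEM IH. Qed.
Lemma place_ringE_nat n p : (n%:R : place_ring) p = n%:R.
Proof. by elim: n => // n IH; rewrite -addn1 !natrD place_ringED IH. Qed.

(** A finitary function factors through the traces of primes on a finite set,
which are encoded by bit vectors. *)
Lemma finitary_range (f : MSpec A -> K) :
  finitary f -> exists vs : seq K, forall p, f p \in vs.
Proof.
move=> [s fs].
pose pattern p := map_tuple (fun a => `[< mspec_set p a >]) (in_tuple s).
pose value b := if pselect (exists p, pattern p = b) is left e then f (projT1 (cid e)) else 0.
exists [seq value b | b <- enum {: (size s).-tuple bool}] => p.
apply/mapP; exists (pattern p); first by rewrite mem_enum.
rewrite /value; case: pselect => [e|[]]; last by exists p.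
case: cid => q /= /(congr1 (@tval _ _)) /= /eq_in_map qp; apply: fs => a a_s.
by apply: iff_sym; apply: asbool_eq_equiv (qp a a_s).
Qed.

(** * The Nullstellensatz *)

(** The quotient f^(N+1) / g, set to 0 where g vanishes, satisfies the residue
condition for q contained in p: if g p is nonzero, residues can be divided; if
g p = 0 then f p = 0, so f q has positive valuation along the complement of p,
and the exponent beats the valuation of g q. *)
Lemma vanishing_radical f g :
  (forall p, g p = 0 -> f p = 0) -> exists n h, f ^+ n = g * h.
Proof.
move=> gf; have [vs gvs] := finitary_range (place_ring_finitary g).
have [N bound] := residue_bound_seq vs.
(* The exponent N.+1 is positive, so that f^(N+1) vanishes with f even if
   N = 0. *)
pose h p := f p ^+ N.+1 / g p.
have hP : h \in place_ring_pred.
  apply/asboolP; split.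
    by apply: finitary2 (fun y z => y ^+ N.+1 / z) _ _ _ _; apply: place_ring_finitary.
  move=> p q qp; rewrite /h.
  have fres := place_ring_residue f qp; have gres := place_ring_residue g qp.
  have [gp0|gp0] := eqVneq (g p) 0; last first.
    by apply: residueM; [apply: residueX|apply: residueV].
  rewrite gp0 invr0 mulr0; have [->|gq0] := eqVneq (g q) 0.
    by rewrite invr0 mulr0; apply: residue0.
  by rewrite (gf p gp0) in fres; apply: bound (leqnSn _) fres.
exists N.+1, (PlaceRing hP); apply: place_ringP => p.
rewrite place_ringEX place_ringEM /= /h.
have [gp0|gp0] := eqVneq (g p) 0; last by rewrite mulrC divfK.
by rewrite gp0 mul0r gf // expr0n.
Qed.

Lemma natr_notin (vs : seq K) : exists n : nat, n%:R \notin vs.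
Proof.
apply: contrapT => h.
have /uniq_leq_size : uniq [seq n%:R : K | n <- iota 0 (size vs).+1].
  by rewrite map_inj_uniq ?iota_uniq //; apply: natr_place_inj.
move=> /(_ vs); rewrite size_map size_iota ltnn => hh.
suff : false by []; apply: hh => z /mapP[n _ ->].
by apply/negPn/negP => nvs; apply: h; exists n.
Qed.

(** Choose n outside the finite set of values of - f / g. *)
Lemma generic_combination f g :
  exists n : nat, forall p, (f + n%:R * g) p = 0 -> f p = 0 /\ g p = 0.
Proof.
have [vs hvs] := finitary_range
  (finitary2 (fun y z => - (y / z)) (place_ring_finitary f) (place_ring_finitary g)).
have [n nvs] := natr_notin vs; exists n => p.
rewrite place_ringED place_ringEM place_ringE_nat.
have [->|gp0] := eqVneq (g p) 0; first by rewrite mulr0 addr0.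
move=> /eqP; rewrite addr_eq0 => /eqP fp; case/negP: nvs.
suff -> : n%:R = - (f p / g p) :> K by apply: hvs.
by rewrite fp mulNr opprK mulfK.
Qed.

Lemma ideal_common_zero (J : set place_ring) (gs : seq place_ring) :
  ring_ideal J -> (forall g, g \in gs -> J g) ->
  exists2 h, J h & forall p, h p = 0 -> forall g, g \in gs -> g p = 0.
Proof.
move=> [J0 JD JM]; elim: gs => [|g gs IH] Jgs; first by exists 0.
have [h Jh hgs] : exists2 h, J h & forall p, h p = 0 -> forall g, g \in gs -> g p = 0.
  by apply: IH => g' g'gs; apply: Jgs; rewrite inE g'gs orbT.
have [n nP] := generic_combination g h; exists (g + n%:R * h).
  by apply: JD; [apply: Jgs; rewrite inE eqxx|rewrite mulrC; apply: JM].
move=> p /nP[gp hp] g'; rewrite inE => /orP[/eqP -> //|]; exact: hgs.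
Qed.

Lemma prime_nullstellensatz (P : Spec place_ring) f (gs : seq place_ring) :
  (forall g, g \in gs -> spec_set P g) ->
  (forall p, (forall g, g \in gs -> g p = 0) -> f p = 0) -> spec_set P f.
Proof.
case: P => P /= Pprime Pgs fgs; case: (Pprime) => Pid PT PM.
have [h Ph hgs] := ideal_common_zero Pid Pgs.
have [n [k e]] : exists n k, f ^+ n = h * k.
  by apply: vanishing_radical => p /hgs; apply: fgs.
have {h hgs k Ph e} : P (f ^+ n) by rewrite e; case: Pid => _ _; apply.
have P1 : ~ P 1.
  by move=> P1; apply/PT/seteqP; split=> // x _; rewrite -(mul1r x); case: Pid => _ _; apply.
elim: n => // n IH; apply: contraPP => Pf; rewrite exprS.
by apply: PM => // /IH.
Qed.

(** * Comparison of the two spectra *)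

Lemma place_ring_gen_subproof a :
  (fun p => if `[< mspec_set p a >] then 0 else generator K a) \in place_ring_pred.
Proof.
apply/asboolP; split.
  exists [:: a] => p q /(_ a (mem_head _ _)) pq.
  by congr (if _ then _ else _); apply/asbool_equiv_eq.
move=> p q qp; have [pa|pa] := pselect (mspec_set p a); last first.
  by rewrite !asboolF //; [apply: residue_generator|move=> /qp].
rewrite (asboolT pa); case: asboolP => qa; first exact: residue0.
by apply: residue_generator0 => /(_ pa).
Qed.
Definition place_ring_gen a : place_ring := PlaceRing (place_ring_gen_subproof a).

Lemma place_ring_gen_eq0 p a : place_ring_gen a p = 0 <-> mspec_set p a.
Proof.
rewrite /=; case: asboolP => // pa; split=> // /eqP.
by rewrite (negPf (generator_neq0 _ _)).
Qed.

Lemma mspec1 p : ~ mspec_set p 1%g.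
Proof.
case: p => p [[_ pM] pT _] /= p1; apply/pT/seteqP; split=> // x _.
by rewrite -(mul1g x); apply: pM.
Qed.

Lemma mspecM p a b : mspec_set p (a * b)%g <-> mspec_set p a \/ mspec_set p b.
Proof.
case: p => p [[_ pM] _ pP] /=; split=> [|[|/pM]]; last by rewrite mmulC; apply.
  by move=> pab; apply: contrapT => /not_orP[pa pb]; apply: (pP a b).
exact: pM.
Qed.

Lemma mspec0 p : mspec_set p mzero.
Proof. by case: p => p [[]]. Qed.

Lemma mspec_eq p q : mspec_set p = mspec_set q -> p = q.
Proof.
case: p q => p pP [q qP] /= pq; rewrite {}pq in pP *.
by congr MkMSpec; apply: Prop_irrelevance.
Qed.

Lemma vanishing_prime p : ring_prime [set f : place_ring | f p = 0].
Proof.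
split; first split=> // f g f0.
- by move=> g0; apply: etrans (place_ringED f g p) _; rewrite [f p]f0 [g p]g0 addr0.
- by apply: etrans (place_ringEM f g p) _; rewrite [f p]f0 mul0r.
- by move=> /seteqP[_ /(_ 1 I)] /= /eqP; rewrite oner_eq0.
- move=> f g /eqP f0 /eqP g0 fg0; move/eqP: (etrans (esym (place_ringEM f g p)) fg0).
  by rewrite mulf_eq0 (negPf f0) (negPf g0).
Qed.
Definition spec_of_mspec p : Spec place_ring := MkSpec (vanishing_prime p).

(** The function attached to ab is not the product of those attached to a and
b, but it has the same zeros, so a prime cannot tell them apart. *)
Lemma spec_genM (P : Spec place_ring) a b :
  spec_set P (place_ring_gen (a * b)%g) <->
  spec_set P (place_ring_gen a) \/ spec_set P (place_ring_gen b).
Proof.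
have [Pid _ PM] := spec_prime P; case: Pid => _ _ PZ; split.
  move=> Pab; apply: contrapT => /not_orP[Pa Pb].
  apply: (PM _ _ Pa Pb); apply: (@prime_nullstellensatz _ _ [:: place_ring_gen (a * b)%g]).
    by move=> g; rewrite inE => /eqP ->.
  move=> p /(_ _ (mem_head _ _))/place_ring_gen_eq0/mspecM ab.
  rewrite place_ringEM; apply/eqP; rewrite mulf_eq0; apply/orP.
  by case: ab => /place_ring_gen_eq0 ->; [left|right].
move=> Pab; pose ab := place_ring_gen a * place_ring_gen b.
apply: (@prime_nullstellensatz _ _ [:: ab]).
  move=> g; rewrite inE => /eqP ->; rewrite /ab.
  by case: Pab => /PZ; [|rewrite mulrC]; apply.
move=> p /(_ _ (mem_head _ _))/eqP; rewrite place_ringEM mulf_eq0.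
move=> e; apply/place_ring_gen_eq0/mspecM.
by case/orP: e => /eqP/place_ring_gen_eq0; [left|right].
Qed.

Lemma trace_prime (P : Spec place_ring) :
  monoid_prime [set a | spec_set P (place_ring_gen a)].
Proof.
have [Pid PT PM] := spec_prime P; split.
- split=> [|a b /= Pa]; last by apply/spec_genM; left.
  have e0 : place_ring_gen mzero = 0.
    by apply: place_ringP => p; apply/place_ring_gen_eq0/mspec0.
  by case: Pid => + _ _; rewrite -e0.
- move=> /seteqP[_ /(_ 1%g I)] /= P1; apply/PT/seteqP; split=> // f _.
  apply: (@prime_nullstellensatz _ _ [:: place_ring_gen 1%g]).
    by move=> g; rewrite inE => /eqP ->.
  by move=> p /(_ _ (mem_head _ _))/place_ring_gen_eq0/mspec1.
- by move=> a b Pa Pb /= /spec_genM[].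
Qed.
Definition mspec_of_spec (P : Spec place_ring) : MSpec A := MkMSpec (trace_prime P).

Lemma spec_of_mspecK : cancel spec_of_mspec mspec_of_spec.
Proof.
by move=> p; apply/mspec_eq/seteqP; split=> a /= /place_ring_gen_eq0.
Qed.

(** A prime containing the elements of [s] that lie in [p] has the same trace on
[s] as [p] exactly when it avoids this element. *)
Definition indicator_away (s : seq A) p : A :=
  (\prod_(b <- s | ~~ `[< mspec_set p b >]) b)%g.

Lemma indicator_awayP s p q :
  mspec_set q (indicator_away s p) <->
  exists b, [/\ b \in s, ~ mspec_set p b & mspec_set q b].
Proof.
rewrite /indicator_away; elim: s => [|c s IH].
  rewrite big_nil; split=> [/mspec1 //|[b []//]].
rewrite big_cons; case: asboolP => pc /=; [rewrite IH|rewrite mspecM IH]; split.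
- by move=> [b [bs pb qb]]; exists b; rewrite inE bs orbT.
- by move=> [b []]; rewrite inE => /orP[/eqP ->|bs pb qb] //; exists b.
- move=> [qc|[b [bs pb qb]]]; first by exists c; rewrite mem_head.
  by exists b; rewrite inE bs orbT.
- move=> [b []]; rewrite inE => /orP[/eqP -> _ qc|bs pb qb]; first by left.
  by right; exists b.
Qed.

(** Let p be the trace of P, let [s] be a finite set controlling f, and let e
be the function attached to the product of the elements of [s] outside p, so
that e is not in P.  At the common zeros of the functions attached to the
elements of [s] in p, all of which are in P, either e vanishes or f takes the
value f p.  If f p = 0 then e f vanishes there, so e f, hence f, is in P.  If f
is in P and f p is nonzero, then e vanishes at the common zeros of f and of
those functions, so e would be in P. *)
Lemma mspec_of_specK : cancel mspec_of_spec spec_of_mspec.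
Proof.
move=> P; set p := mspec_of_spec P.
suff E f : f p = 0 <-> spec_set P f.
  case: P @p E => P PP /= E; rewrite /spec_of_mspec.
  move: (vanishing_prime _) => Q.
  have e : [set f : place_ring | f (mspec_of_spec (MkSpec PP)) = 0] = P.
    by apply/seteqP; split=> f /= /E.
  by move: Q; rewrite e => Q; congr MkSpec; apply: Prop_irrelevance.
have [s fs] := place_ring_finitary f; have [Pid _ PM] := spec_prime P.
pose gs := [seq place_ring_gen b | b <- s & `[< mspec_set p b >]].
have Pgs g : g \in gs -> spec_set P g.
  by move=> /mapP[b]; rewrite mem_filter => /andP[/asboolP pb _ ->].
pose e := place_ring_gen (indicator_away s p).
have Pe : ~ spec_set P e.
  by move=> Pe; have [b []] := (indicator_awayP s p p).1 Pe.
have gsE q : (forall g, g \in gs -> g q = 0) -> e q != 0 -> f p = f q.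
  move=> gsq eq0; apply: fs => b bs; split=> [pb|qb].
    apply/place_ring_gen_eq0/gsq/map_f; rewrite mem_filter bs andbT.
    exact/asboolP.
  apply: contrapT => pb; case/negP: eq0; apply/eqP/place_ring_gen_eq0.
  by apply/indicator_awayP; exists b.
split=> [fp0|Pf].
  apply: contrapT => Pf; apply: (PM _ _ Pe Pf).
  apply: (prime_nullstellensatz Pgs) => q /gsE gsq.
  rewrite place_ringEM; have [->|/gsq <-] := eqVneq (e q) 0; first by rewrite mul0r.
  by rewrite fp0 mulr0.
apply: contrapT => fp0; apply: Pe.
apply: (@prime_nullstellensatz _ _ (f :: gs)).
  by move=> g; rewrite inE => /orP[/eqP ->|/Pgs].
move=> q fgsq; apply: contrapT => /eqP eq0; apply: fp0.
rewrite (gsE q) // ?fgsq ?mem_head // => g ggs.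
by apply: fgsq; rewrite inE ggs orbT.
Qed.

(** This holds for monoids and fails for rings because there is no addition
under which the union should be closed. *)
Lemma mspec_setU_prime p q : monoid_prime (mspec_set p `|` mspec_set q).
Proof.
split.
- split=> [|a b [pa|qa]]; first by left; apply: mspec0.
    by left; apply/mspecM; left.
  by right; apply/mspecM; left.
- by move=> /seteqP[_ /(_ 1%g I)] [] /mspec1.
- by move=> a b /not_orP[pa qa] /not_orP[pb qb] [] /mspecM[].
Qed.

(** Take for a the product of the elements outside p of a finite set controlling
f.  If q avoids a, then p and the prime p `|` q have the same trace on that
finite set, so f is nonzero at p `|` q; and f q has the residue f (p `|` q). *)
Lemma place_ring_neq0_open f p : f p != 0 -> exists2 a, ~ mspec_set p a &
  forall q, ~ mspec_set q a -> f q != 0.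
Proof.
move=> fp0; have [s fs] := place_ring_finitary f.
exists (indicator_away s p); first by move=> /indicator_awayP[b []].
move=> q qa; pose r := MkMSpec (mspec_setU_prime p q).
have fr : f p = f r.
  apply: fs => b bs; split=> [pb|[//|qb]]; first by left.
  by apply: contrapT => pb; apply: qa; apply/indicator_awayP; exists b.
have qr : q `<=` r by move=> b qb; right.
move: fp0; rewrite fr; apply: contra_neq => fq0.
by have := place_ring_residue f qr; rewrite fq0 => /residue_0l.
Qed.

(** The set Z of the common zeros of J is cut out by the intersection of the
primes it consists of: if some f in J is nonzero at p, then
[place_ring_neq0_open] gives an a outside p that belongs to every prime in Z. *)
Lemma spec_of_mspec_continuous : continuous spec_of_mspec.
Proof.
apply/continuousP => U [J _ UJ].
exists [set a | forall p, (forall f, J f -> f p = 0) -> mspec_set p a].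
  split=> [p _|a b aJ p Jp]; first exact: mspec0.
  by apply/mspecM; left; apply: aJ.
rewrite preimage_setC UJ; apply/seteqP; split=> p /=.
  by move=> Jp a; apply.
move=> Jp f Jf /=; apply/eqP/negPn/negP => /place_ring_neq0_open[a pa fa].
by apply/pa/Jp => q qJ; apply: contrapT => /fa; rewrite qJ // eqxx.
Qed.

Lemma mspec_of_spec_continuous : continuous mspec_of_spec.
Proof.
apply/continuousP => U [J _ UJ].
exists [set f | forall P : Spec place_ring,
  (forall a, J a -> spec_set P (place_ring_gen a)) -> spec_set P f].
  split=> [P _|f g fJ gJ P PJ|f g fJ P PJ]; have [[P0 PD PZ] _ _] := spec_prime P => //.
    by apply: PD; [apply: fJ|apply: gJ].
  exact/PZ/fJ.
rewrite preimage_setC UJ; apply/seteqP; split=> P /=.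
  by move=> JP f; apply.
by move=> JP a Ja; apply: JP => Q; apply.
Qed.
End PlaceRing.

Theorem proposition3p1 (A : pointedMonoidType) : spectral_space (MSpec A).
Proof.
exists (place_ring (polyfun_places A)), (@spec_of_mspec _ _), (@mspec_of_spec _ _).
split; [exact: spec_of_mspec_continuous|exact: mspec_of_spec_continuous|
  exact: spec_of_mspecK|exact: mspec_of_specK].
Qed.
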